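(* Let $\varphi:\overline{\mathbb{D}}\to\overline{\mathbb{D}}$, $\varphi\in A(\mathbb{D})$, be a hyperbolic symbol with Denjoy-Wolff point $z_0\in\partial\mathbb{D}$. Assume that $\varphi$ is holomorphic in a neighbourhood of $z_0$. The following are equivalent: (i) $C_\varphi:A(\mathbb{D})\to A(\mathbb{D})$, $C_\varphi f=f\circ\varphi$, is mean ergodic on $A(\mathbb{D})$; (ii) $\lim_n\varphi^n(z)=z_0$ for all $z\in\overline{\mathbb{D}}$.
   Context: $\mathbb{D}$ is the open unit disc in $\mathbb{C}$. $A(\mathbb{D})$ is the disc algebra: the Banach space of functions continuous on $\overline{\mathbb{D}}$ and holomorphic on $\mathbb{D}$, with the sup norm. A symbol is a holomorphic map $\varphi$ with $\varphi(\mathbb{D})\subseteq\mathbb{D}$. $\varphi^n=\varphi\circ\cdots\circ\varphi$ ($n$ times). If a symbol $\varphi$ is neither the identity nor an automorphism of $\mathbb{D}$ with exactly one fixed point in $\mathbb{D}$, its Denjoy-Wolff point is the unique $z_0\in\overline{\mathbb{D}}$ such that $\varphi^n\to z_0$ uniformly on compact subsets of $\mathbb{D}$. A symbol $\varphi\in A(\mathbb{D})$ with Denjoy-Wolff point $z_0\in\partial\mathbb{D}$ is hyperbolic if $\varphi'(z_0)<1$, where $\varphi'(z_0)$ is the angular derivative at $z_0$ (which is the usual derivative when $\varphi$ extends holomorphically to a neighbourhood of $z_0$). ''Holomorphic in a neighbourhood of $z_0$'' means that $\varphi$ extends holomorphically to a neighbourhood of $z_0$ in $\mathbb{C}$. A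 bounded operator $T$ on a Banach space $X$ is mean ergodic if $\frac1n\sum_{m=1}^nT^m$ converges in the strong operator topology to some bounded operator on $X$. *)

(* Defs.v *)
From HB Require Import structures.
From mathcomp Require Import all_boot all_order all_algebra.
From mathcomp Require Import all_classical all_reals all_analysis.
From mathcomp Require Import complex.
Import Order.TTheory GRing.Theory Num.Theory numFieldNormedType.Exports.
Set Implicit Arguments.
Unset Strict Implicit.
Unset Printing Implicit Defensive.
Local Open Scope classical_set_scope.
Local Open Scope ring_scope.
Local Open Scope complex_scope.

(* The norm on [R[i]] is [R[i]]-valued; these instances make the field [R[i]]
   a normed space over itself, so that [derivable f z 1] is complex
   differentiability. *)
HB.instance Definition _ (R : realType) := NormedModule.copy R[i] (R[i]^o).
HB.instance Definition _ (R : realType) := Num.ClosedField.on R[i].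

Section Disc.
Variable R : realType.
Local Notation C := R[i].
Implicit Types (z w : C).

Definition unit_disc : set C := [set z | `|z| < 1].
Definition closed_unit_disc : set C := [set z | `|z| <= 1].

Definition holomorphic_on (U : set C) (f : C -> C) : Prop :=
  forall z, U z -> derivable f z 1.

Lemma normcE z : `|z| = (Normc.normc z)%:C.
Proof. by []. Qed.

Lemma gt0_complexE z : 0 < z -> z = (complex.Re z)%:C /\ 0 < complex.Re z.
Proof. by case: z => a b; rewrite ltcE /= => /andP[/eqP -> ->]. Qed.

Lemma normc_ge0 z : 0 <= Normc.normc z.
Proof. by rewrite -lecR -normcE normr_ge0. Qed.

Lemma normc_continuous : continuous (@Normc.normc R : C -> R).
Proof.
move=> z; apply/(@cvgrPdist_lt _ _ _ (nbhs z) (nbhs_filter z)) => e e0.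
have e0' : 0 < e%:C :> C by rewrite ltcR.
near=> w.
have zw : `|z - w| < e%:C by near: w; exact: cvgr_dist_lt.
rewrite -ltcR; apply: le_lt_trans zw.
have := ler_dist_dist z w.
by rewrite !normcE -rmorphB /= expr0n /= addr0 sqrtr_sqr.
Unshelve. all: by end_near. Qed.


Lemma real_complex_continuous : continuous (real_complex R : R -> C).
Proof.
move=> x; apply/cvgrPdist_lt => e /gt0_complexE[-> e0].
near=> y.
rewrite -rmorphB /= normcE ltcR /= expr0n /= addr0 sqrtr_sqr.
by near: y; exact: cvgr_dist_lt.
Unshelve. all: by end_near. Qed.

Lemma closed_unit_disc_compact : compact closed_unit_disc.
Proof.
pose g (p : R * R) : C := p.1%:C + 'i * p.2%:C.
have gc : continuous g.
  move=> p; apply: cvgD.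
    by apply: continuous_comp; [exact: cvg_fst|exact: real_complex_continuous].
  apply: cvgM; first exact: cvg_cst.
  by apply: continuous_comp; [exact: cvg_snd|exact: real_complex_continuous].
apply: (@subclosed_compact _ _ (g @` (`[-1, 1]%classic `*` `[-1, 1]%classic))).
- rewrite (_ : closed_unit_disc = @Normc.normc R @^-1` [set x | x <= 1]).
    by apply: closed_comp => [z _|]; [exact: normc_continuous|exact: closed_le].
  by apply/seteqP; split => z; rewrite /closed_unit_disc /= normcE lecR.
- apply: continuous_compact; first exact: continuous_subspaceT.
  by apply: compact_setX; exact: segment_compact.
- move=> [a b]; rewrite /closed_unit_disc /= normcE lecR /= => ab1.
  have ab : a ^+ 2 + b ^+ 2 <= 1.
    rewrite -[leRHS](expr1n _ 2) -(sqr_sqrtr (addr_ge0 (sqr_ge0 a) (sqr_ge0 b))).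
    by rewrite lerXn2r ?nnegrE ?sqrtr_ge0.
  have h (x y : R) : x ^+ 2 + y ^+ 2 <= 1 -> -1 <= x <= 1.
    move=> xy; rewrite -ler_norml -(expr_le1 (n := 2)) // -normrX ger0_norm ?sqr_ge0 //.
    by apply: le_trans xy; rewrite lerDl sqr_ge0.
  exists (a, b).
    by split; rewrite /= in_itv /=; [exact: h ab|apply: (h b a); rewrite addrC].
  by rewrite /g /=; simpc.
Qed.

(* Functions on the closed disc are represented by functions on the plane
   that vanish off the closed disc, so that equality in [disc_algebra] is
   equality on the closed disc. *)
Definition in_disc_algebra (f : C -> C) : Prop :=
  [/\ {within closed_unit_disc, continuous f}, holomorphic_on unit_disc f
    & forall z, ~ closed_unit_disc z -> f z = 0].

Definition disc_algebra_pred : {pred C -> C} := fun f => `[< in_disc_algebra f >].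

Record disc_algebra := DiscAlgebra {
  disc_fun :> C -> C;
  disc_funP : disc_fun \in disc_algebra_pred }.

HB.instance Definition _ := [isSub for disc_fun].
HB.instance Definition _ := [Choice of disc_algebra by <:].

Lemma disc_algebra_submod : submod_closed disc_algebra_pred.
Proof.
split.
  apply/asboolP; split => [z|z _|//]; first exact: cvg_cst.
  exact: derivable_cst.
move=> a f g /asboolP[fc fh f0] /asboolP[gc gh g0]; apply/asboolP; split.
- move=> z; apply: cvgD; last exact: gc.
  by apply: cvgZr; exact: fc.
- move=> z zD; apply: derivableD; last exact: gh.
  by apply: derivableZ; exact: fh.
- by move=> z zD; rewrite -[LHS]/(a *: f z + g z) f0 // g0 // addr0 scaler0.
Qed.

HB.instance Definition _ :=
  GRing.isSubmodClosed.Build R[i] (C -> C) disc_algebra_pred disc_algebra_submod.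
HB.instance Definition _ :=
  [SubChoice_isSubLmodule of disc_algebra by <:].

Lemma disc_algebraP (f : disc_algebra) : in_disc_algebra f.
Proof. by apply/asboolP; exact: disc_funP. Qed.

Lemma disc_algebra_ext (f g : disc_algebra) :
  (forall z, closed_unit_disc z -> f z = g z) -> f = g.
Proof.
move=> fg; apply: val_inj; apply/funext => z /=.
have [zD|zD] := pselect (closed_unit_disc z); first exact: fg.
have [_ _ ->//] := disc_algebraP f.
by have [_ _ ->] := disc_algebraP g.
Qed.

Definition sup_norm (f : disc_algebra) : R :=
  sup [set Normc.normc (f z) | z in closed_unit_disc].

Lemma closed_unit_disc0 : closed_unit_disc 0.
Proof. by rewrite /closed_unit_disc /= normr0 ler01. Qed.

Lemma le_sup_norm (f : disc_algebra) z :
  closed_unit_disc z -> Normc.normc (f z) <= sup_norm f.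
Proof.
move=> zD; apply: ub_le_sup; last by exists z.
have [fc _ _] := disc_algebraP f.
have /compact_bounded [M [_ hM]] :
    compact ((@Normc.normc R \o f) @` closed_unit_disc).
  apply: continuous_compact closed_unit_disc_compact.
  by apply: within_continuous_comp fc => w _; exact: normc_continuous.
exists (M + 1) => _ [w wD <-].
apply: le_trans (ler_norm _) _; apply: (hM (M + 1)); first by rewrite ltrDl.
by exists w.
Qed.

Lemma sup_norm_le (f : disc_algebra) M :
  (forall z, closed_unit_disc z -> Normc.normc (f z) <= M) -> sup_norm f <= M.
Proof.
move=> fM; apply: ge_sup; first by exists (Normc.normc (f 0)), 0 => //; exact: closed_unit_disc0.
by move=> _ [z zD <-]; exact: fM.
Qed.

Lemma sup_norm_ge0 (f : disc_algebra) : 0 <= sup_norm f.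
Proof.
by apply: le_trans (normc_ge0 (f 0)) _; apply: le_sup_norm closed_unit_disc0.
Qed.

Let disc_norm (f : disc_algebra) : C := (sup_norm f)%:C.

Let disc_normD f g : disc_norm (f + g) <= disc_norm f + disc_norm g.
Proof.
rewrite -rmorphD lecR; apply: sup_norm_le => z zD.
apply: (@le_trans _ _ (Normc.normc (f z) + Normc.normc (g z))).
  by rewrite -lecR rmorphD -!normcE; exact: ler_normD.
by apply: lerD; exact: le_sup_norm.
Qed.

Let sup_normZ_le (l : C) (f : disc_algebra) :
  sup_norm (l *: f) <= Normc.normc l * sup_norm f.
Proof.
apply: sup_norm_le => z zD; rewrite -[(l *: f) z]/(l * f z) Normc.normcM.
by apply: ler_wpM2l; [exact: normc_ge0|exact: le_sup_norm].
Qed.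

Let disc_normZ (l : C) f : disc_norm (l *: f) = `|l| * disc_norm f.
Proof.
rewrite normcE -rmorphM; congr (_ %:C); apply/eqP; rewrite eq_le sup_normZ_le /=.
have [->|l0] := eqVneq l 0.
  by rewrite Normc.normc0 mul0r sup_norm_ge0.
rewrite -[in leLHS](scalerK l0 f) -ler_pdivlMl.
  by rewrite -Normc.normcV sup_normZ_le.
by rewrite -ltcR -normcE normr_gt0.
Qed.

Let disc_norm0_eq0 f : disc_norm f = 0 -> f = 0.
Proof.
move=> /complexI f0; apply: disc_algebra_ext => z zD.
apply: Normc.eq0_normc; apply/eqP.
by rewrite eq_le normc_ge0 -[leRHS]f0 le_sup_norm.
Qed.

HB.instance Definition _ := Lmodule_isNormed.Build R[i] disc_algebra
  disc_normD disc_normZ disc_norm0_eq0.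

Lemma disc_algebra_normE (f : disc_algebra) : `|f| = (sup_norm f)%:C.
Proof. by []. Qed.


Record disc_symbol := DiscSymbol {
  symbol_fun :> disc_algebra;
  symbol_disc : set_fun unit_disc unit_disc symbol_fun;
  symbol_closed_disc : set_fun closed_unit_disc closed_unit_disc symbol_fun }.

Section CompositionOperator.
Variable phi : disc_symbol.

Let comp_fun (f : disc_algebra) : C -> C :=
  fun z => if `|z| <= 1 then f (phi z) else 0.

Let comp_funE f z : closed_unit_disc z -> comp_fun f z = f (phi z).
Proof. by rewrite /closed_unit_disc /comp_fun /= => ->. Qed.

Let comp_fun_in f : comp_fun f \in disc_algebra_pred.
Proof.
have [fc fh f0] := disc_algebraP f.
have [pc ph p0] := disc_algebraP phi.
apply/asboolP; split.
- apply/subspace_continuousP => z zD; rewrite /from_subspace comp_funE //.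
  apply: (@cvg_trans _ ((f \o phi) @ within closed_unit_disc (nbhs z))).
    apply: near_eq_cvg; rewrite near_withinE; near=> w => wD.
    by rewrite comp_funE.
  apply: (@cvg_comp _ _ _ _ _ _ (within closed_unit_disc (nbhs (phi z)))).
    move=> A; rewrite /within /= => /((subspace_continuousP _ _).1 pc z zD).
    rewrite /nbhs /= /within /=; apply: filterS => w hw wD.
    by apply: hw => //; exact: symbol_closed_disc.
  by apply: (subspace_continuousP _ _).1 fc _ _; exact: symbol_closed_disc.
- move=> z zD.
  have : derivable (f \o phi) z 1.
    apply/derivable1_diffP; apply: differentiable_comp.
      by apply/derivable1_diffP; exact: ph.
    by apply/derivable1_diffP; apply: fh; exact: symbol_disc.
  apply: near_eq_derivable.
  have : \forall w \near z, Normc.normc w < 1.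
    apply: (@normc_continuous z [set x : R | x < 1]).
    by apply: open_nbhs_nbhs; split; [exact: open_lt|rewrite /= -ltcR].
  apply: filterS => w w1; rewrite comp_funE //.
  by rewrite /closed_unit_disc /= normcE lecR ltW.
- by move=> z zD; rewrite /comp_fun; case: ifP => // /zD.
Unshelve. all: by end_near. Qed.

Definition comp_op (f : disc_algebra) : disc_algebra :=
  DiscAlgebra (comp_fun_in f).

Lemma comp_opE f z : closed_unit_disc z -> comp_op f z = f (phi z).
Proof. exact: comp_funE. Qed.

Lemma comp_op_is_linear : linear comp_op.
Proof.
move=> a f g; apply: disc_algebra_ext => z zD.
by rewrite -[RHS]/(a * comp_op f z + comp_op g z) !comp_opE.
Qed.

HB.instance Definition _ :=
  GRing.isLinear.Build R[i] disc_algebra disc_algebra _ comp_op comp_op_is_linear.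

Lemma comp_op_continuous : continuous comp_op.
Proof.
apply: bounded_linear_continuous; apply/linear_boundedP.
near=> r => f; rewrite !disc_algebra_normE.
apply: (@le_trans _ _ (sup_norm f)%:C).
  rewrite lecR; apply: sup_norm_le => z zD; rewrite comp_opE //.
  by apply: le_sup_norm; exact: symbol_closed_disc.
have r1 : 1 <= r by near: r; apply: nbhs_pinfty_ge; rewrite real1.
by rewrite -[leLHS]mul1r ler_wpM2r // lecR sup_norm_ge0.
Unshelve. all: by end_near. Qed.

End CompositionOperator.

(* Stolz region with vertex [zeta]; a nontangential limit is a limit within
   every such region. *)
Definition stolz_region (zeta : C) (M : R) : set C :=
  [set z | unit_disc z /\ `|z - zeta| < M%:C * (1 - `|z|)].

Definition has_angular_derivative (f : C -> C) (zeta d : C) : Prop :=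
  exists2 eta : C, `|eta| = 1 & forall M : R, 1 < M ->
    (f z - eta) / (z - zeta) @[z --> within (stolz_region zeta M) (nbhs zeta)]
      --> d.

(* This convergence already excludes the identity and the automorphisms with a
   single fixed point in the disc. *)
Definition denjoy_wolff_point (f : C -> C) (z0 : C) : Prop :=
  closed_unit_disc z0 /\
  forall K : set C, compact K -> K `<=` unit_disc ->
    {uniform K, (fun n => iter n f) @ \oo --> (cst z0 : C -> C)}.

Definition hyperbolic (f : C -> C) (z0 : C) : Prop :=
  [/\ `|z0| = 1, denjoy_wolff_point f z0
    & exists2 d : R, has_angular_derivative f z0 d%:C & d < 1].

Definition holomorphic_extension_near (f : C -> C) (z0 : C) : Prop :=
  exists2 g : C -> C, \forall w \near z0, derivable g w 1
    & \forall w \near z0, closed_unit_disc w -> g w = f w.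

End Disc.

Definition mean_ergodic (K : numFieldType) (X : normedModType K)
    (T : {linear X -> X}) : Prop :=
  continuous T /\
  exists2 P : {linear X -> X}, continuous P
    & forall x, n%:R^-1 *: (\sum_(1 <= m < n.+1) iter m T x) @[n --> \oo] --> P x.

(* Main.v *)
Require Import Defs.
From HB Require Import structures.
From mathcomp Require Import all_boot all_order all_algebra.
From mathcomp Require Import all_classical all_reals all_analysis.
From mathcomp Require Import complex ring lra.
Import Order.TTheory GRing.Theory Num.Theory numFieldNormedType.Exports.
Set Implicit Arguments.
Unset Strict Implicit.
Unset Printing Implicit Defensive.
Local Open Scope classical_set_scope.
Local Open Scope ring_scope.
Local Open Scope complex_scope.

(* Radial limits show that the extension of [phi] at the fixed point [z0] has
   derivative [d] with [0 <= d < 1], so [phi] contracts towards [z0] near [z0]: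
   an orbit that comes close to [z0] converges to it.  If every orbit converges,
   compactness makes the convergence uniform on the closed disc, so the powers
   of the composition operator, hence their means, converge strongly to
   evaluation at [z0].  Conversely, if the operator is mean ergodic, the limit
   of the means of [phi] itself is continuous and equals [z0] on the open disc,
   hence on the closed disc; as [z0] is an extreme point of the disc, each orbit
   comes close to [z0]. *)

(** * Real-valued norms and Cesàro means in complex normed spaces *)

Lemma Re_le_norm (R : realType) (z : R[i]) : (complex.Re z)%:C <= `|z|.
Proof.
by apply: le_trans (normc_ge_Re z); rewrite lecR ler_norm.
Qed.

Lemma norm_realE (R : realType) (V : normedModType R[i]) (v : V) :
  `|v| = (complex.Re `|v|)%:C.
Proof.
have := normr_ge0 v; rewrite le_eqVlt => /predU1P[<-//|].
by move=> /gt0_complexE[].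
Qed.

Lemma norm_real_complex (R : realType) (x : R) : `|x%:C| = `|x|%:C.
Proof. by rewrite Defs.normcE /= expr0n /= addr0 sqrtr_sqr. Qed.

Lemma real_complex_cvg (R : realType) T (F : set_system T) (FF : Filter F)
  (f : T -> R) (l : R) : f @ F --> l -> (f x)%:C @[x --> F] --> (l%:C : R[i]).
Proof. by move=> fl; exact: continuous_cvg (@real_complex_continuous R l) fl. Qed.

(** By the triangle inequality the mean is no farther from [l] than the mean of the real numbers
    [r n], so the real Cesàro theorem suffices. *)
Lemma cvg_cesaro (R : realType) (V : normedModType R[i]) (u : nat -> V) (l : V) :
  u @ \oo --> l ->
  n%:R^-1 *: (\sum_(1 <= m < n.+1) u m) @[n --> \oo] --> l.
Proof.
move=> ul; pose r n : R := complex.Re `|l - u n.+1|.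
have rE n : `|l - u n.+1| = (r n)%:C by exact: norm_realE.
have r0 : r @ \oo --> (0 : R).
  apply/cvgrPdist_lt => e e0.
  have e0' : 0 < e%:C :> R[i] by rewrite ltcR.
  have /cvgrPdist_lt/(_ _ e0') : u n.+1 @[n --> \oo] --> l.
    by rewrite -(cvg_shiftS u) in ul.
  apply: filterS => n; rewrite rE ltcR sub0r normrN ger0_norm //.
  by rewrite -ler0c -rE.
(* [arithmetic_mean r n] averages the [n.+1] values [r 0], ..., [r n], that is, the distances of
   [u 1], ..., [u n.+1] to [l]; shifting the goal by one aligns the two means. *)
rewrite -cvg_shiftS; apply/cvgrPdist_lt => e /gt0_complexE[-> e0].
have /cvgrPdist_lt/(_ _ e0) := cesaro r0.
apply: filterS => n; rewrite sub0r normrN => rn.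
apply: (@le_lt_trans _ _ (arithmetic_mean r n)%:C); last first.
  by rewrite ltcR; apply: le_lt_trans rn; exact: ler_norm.
have n0 : n.+1%:R != 0 :> R[i] by rewrite pnatr_eq0.
rewrite /= big_add1 /= -[X in X - _](scalerK n0) -scalerBr normrZ.
rewrite scaler_nat.
rewrite (_ : l *+ n.+1 = \sum_(0 <= i < n.+1) l); last first.
  by rewrite sumr_const_nat subn0.
rewrite -sumrB rmorphM fmorphV rmorph_nat normrV ?unitfE// normr_nat.
apply: ler_wpM2l; first by rewrite invr_ge0 ler0n.
apply: le_trans (ler_norm_sum _ _ _) _.
by rewrite /series /= rmorph_sum; apply: ler_sum => i _; rewrite rE.
Qed.

(** * Radial approach to a point of the closed disc *)

Definition radial (R : realType) (z : R[i]) (t : R) : R[i] := (1 - t%:C) * z.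

Lemma cvg_radial (R : realType) (z : R[i]) : radial z t @[t --> (0 : R)^'+] --> z.
Proof.
have h T (F : set_system T) (FF : Filter F) (f : T -> R) :
    f @ F --> (0 : R) -> radial z (f x) @[x --> F] --> z.
  move=> f0; rewrite -[X in _ --> X](_ : radial z 0 = z); last first.
    by rewrite /radial subr0 mul1r.
  apply: (@cvgM R[i] T F FF (fun x => 1 - (f x)%:C)); last exact: cvg_cst.
  apply: (@cvgB R[i] R[i] T F FF (fun _ => 1) (fun x => (f x)%:C)).
    exact: cvg_cst.
  exact: real_complex_cvg.
by apply: h; exact: cvg_within.
Qed.

Lemma radial_scale_ge0 (R : realType) (t : R) : 0 < t < 1 -> 0 <= 1 - t%:C.
Proof.
by move=> /andP[_ t1]; rewrite subr_ge0 -(rmorph1 (real_complex R)) lecR ltW.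
Qed.

Lemma norm_radial (R : realType) (z : R[i]) (t : R) : 0 < t < 1 ->
  `|radial z t| = (1 - t%:C) * `|z|.
Proof. by move=> t01; rewrite normrM ger0_norm ?radial_scale_ge0. Qed.

Lemma near_radial (R : realType) : \forall t \near (0 : R)^'+, 0 < t < 1.
Proof.
near=> t; apply/andP; split; first by near: t; exact: nbhs_right_gt.
by near: t; apply: nbhs_right_lt.
Unshelve. all: by end_near. Qed.

Lemma radial_unit_disc (R : realType) (z : R[i]) (t : R) : 0 < t < 1 ->
  closed_unit_disc z -> unit_disc (radial z t).
Proof.
move=> t01; rewrite /closed_unit_disc /unit_disc /= norm_radial // => z1.
have /andP[t0 t1] := t01.
apply: (@le_lt_trans _ _ (1 - t%:C)).
  by rewrite ler_piMr // radial_scale_ge0.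
by rewrite ltrBlDr ltrDl ltcR.
Qed.

Lemma radialB (R : realType) (z : R[i]) (t : R) :
  radial z t - z = - (t%:C * z).
Proof. by rewrite /radial mulrBl mul1r addrAC subrr sub0r. Qed.

Lemma norm_radialB (R : realType) (z : R[i]) (t : R) : 0 < t -> `|z| = 1 ->
  `|radial z t - z| = t%:C.
Proof.
move=> t0 z1; rewrite radialB.
by rewrite normrN normrM z1 mulr1 norm_real_complex gtr0_norm.
Qed.

(** On the radius the distance to [z] and the distance to the circle are both [t], so every aperture
    [M > 1] is wide enough. *)
Lemma radial_stolz (R : realType) (z : R[i]) (t M : R) : 0 < t < 1 -> 1 < M ->
  `|z| = 1 -> stolz_region z M (radial z t).
Proof.
move=> t01 M1 z1; have /andP[t0 _] := t01.
split; first by apply: radial_unit_disc; rewrite /closed_unit_disc /= ?z1.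
rewrite norm_radial // z1 mulr1 subKr norm_radialB //.
by rewrite -rmorphM ltcR ltr_pMl.
Qed.

(** * Iterates of the symbol, and limits and norms in the disc algebra *)

Lemma unit_disc_closed (R : realType) (z : R[i]) : unit_disc z -> closed_unit_disc z.
Proof. exact: ltW. Qed.

Lemma closed_unit_disc_iter (R : realType) (phi : disc_symbol R) n z :
  closed_unit_disc z -> closed_unit_disc (iter n phi z).
Proof. by move=> z1; elim: n => //= n; exact: symbol_closed_disc. Qed.

Lemma unit_disc_iter (R : realType) (phi : disc_symbol R) n z :
  unit_disc z -> unit_disc (iter n phi z).
Proof. by move=> z1; elim: n => //= n; exact: symbol_disc. Qed.

Lemma iter_comp_opE (R : realType) (phi : disc_symbol R) n f z :
  closed_unit_disc z -> iter n (comp_op phi) f z = f (iter n phi z).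
Proof.
elim: n z => // n IHn z z1.
by rewrite iterS comp_opE // IHn ?iterSr //; exact: symbol_closed_disc.
Qed.

(** Continuity of [f] is only relative to the closed disc, where [u] therefore has to stay
    eventually. *)
Lemma disc_algebra_cvg (R : realType) (f : disc_algebra R) z T (F : set_system T)
    (FF : Filter F) (u : T -> R[i]) :
  closed_unit_disc z -> (\forall x \near F, closed_unit_disc (u x)) ->
  u @ F --> z -> f \o u @ F --> f z.
Proof.
move=> z1 u1 uz; have [fc _ _] := disc_algebraP f.
have := (subspace_continuousP _ _).1 fc z z1; apply: cvg_comp.
move=> A /= Az; have := uz _ Az; rewrite /= => uA.
by apply: filterS2 u1 uA => x x1; exact.
Qed.

Lemma iter_symbol_cvg (R : realType) (phi : disc_symbol R) n z :
  closed_unit_disc z ->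
  iter n phi w @[w --> within (closed_unit_disc (R := R)) (nbhs z)] --> iter n phi z.
Proof.
move=> z1; elim: n => [|n IHn] /=; first exact: cvg_within.
apply: disc_algebra_cvg => //; first exact: closed_unit_disc_iter.
by rewrite near_withinE; apply: nearW => w w1; exact: closed_unit_disc_iter.
Qed.

Lemma disc_algebra_norm_ge (R : realType) (f : disc_algebra R) z :
  closed_unit_disc z -> `|f z| <= `|f|.
Proof. by move=> z1; rewrite disc_algebra_normE Defs.normcE lecR le_sup_norm. Qed.

Lemma disc_algebra_norm_le (R : realType) (f : disc_algebra R) (e : R[i]) :
  0 <= e -> (forall z, closed_unit_disc z -> `|f z| <= e) -> `|f| <= e.
Proof.
move=> e0 fe; have eE : e = (complex.Re e)%:C.
  by move: e0; rewrite le_eqVlt => /predU1P[<-//|/gt0_complexE[]].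
rewrite eE disc_algebra_normE lecR; apply: sup_norm_le => z z1.
by rewrite -lecR -Defs.normcE -eE fe.
Qed.

Lemma complex_cvg_unique (R : realType) T (F : set_system T) (FF : ProperFilter F)
  (f : T -> R[i]) (a b : R[i]) : f @ F --> a -> f @ F --> b -> a = b.
Proof.
move=> fa fb; have hR : hausdorff_space R[i] := @norm_hausdorff _ R[i].
exact: (cvg_unique hR fa fb).
Qed.

(** * The Denjoy-Wolff point as an attracting fixed point *)

Lemma denjoy_wolff_cvg (R : realType) (phi : disc_symbol R) (z0 z : R[i]) :
  denjoy_wolff_point phi z0 -> unit_disc z -> iter n phi z @[n --> \oo] --> z0.
Proof.
move=> [_ dw] z1; have /dw : compact [set z] by exact: compact_set1.
rewrite uniform_set1; first by apply=> _ ->.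
Qed.

(** The orbit of [0] and its image under [phi] have the same limit [z0], and [phi] is continuous on
    the closed disc. *)
Lemma denjoy_wolff_fixed (R : realType) (phi : disc_symbol R) (z0 : R[i]) :
  denjoy_wolff_point phi z0 -> phi z0 = z0.
Proof.
move=> dw; have [z01 _] := dw.
have O1 : unit_disc (0 : R[i]) by rewrite /unit_disc /= normr0.
have itz := denjoy_wolff_cvg dw O1.
have h : phi (iter n phi 0) @[n --> \oo] --> phi z0.
  apply: disc_algebra_cvg => //; apply: nearW => n.
  exact/unit_disc_closed/unit_disc_iter.
rewrite -(cvg_shiftS (fun n => iter n phi 0)) in itz.
exact: (complex_cvg_unique _ h itz).
Qed.

Lemma near_subr (R : realType) (z : R[i]) (P : set R[i]) :
  (\forall h \near 0, P h) -> \forall w \near z, P (w - z).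
Proof.
move=> /nbhs_normP[e /= e0 eP]; apply/nbhs_normP; exists e => //= w we.
by apply: eP; rewrite /= sub0r opprB.
Qed.

(** The denominator is [- t z0], so the quotient is [(1 - w / z0) / t] with [w / z0] in the closed
    disc. *)
Lemma Re_radial_quotient_ge0 (R : realType) (phi : disc_symbol R) (z0 : R[i]) (t : R) :
  `|z0| = 1 -> 0 < t < 1 ->
  0 <= complex.Re ((phi (radial z0 t) - z0) / (radial z0 t - z0)).
Proof.
move=> z01 t01; have /andP[t0 _] := t01.
have z0N : z0 != 0 by rewrite -normr_eq0 z01 oner_eq0.
have tN : t%:C != 0 :> R[i] by rewrite gt_eqF // ltcR.
set w := phi _.
have w1 : `|w| <= 1.
  apply: symbol_closed_disc; apply: unit_disc_closed; apply: radial_unit_disc => //.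
  by rewrite /closed_unit_disc /= z01.
have -> : (w - z0) / (radial z0 t - z0) = (t^-1)%:C * (1 - w / z0).
  rewrite radialB fmorphV.
  by field; rewrite tN z0N.
have -> : complex.Re ((t^-1)%:C * (1 - w / z0)) = t^-1 * (1 - complex.Re (w / z0)).
  by case: (w / z0) => a b; simpc.
rewrite mulr_ge0 ?invr_ge0 ?(ltW t0) // subr_ge0 -lecR.
by apply: le_trans (Re_le_norm _) _; rewrite normrM normfV z01 invr1 mulr1.
Qed.

(** A convergent quotient with vanishing denominator has a vanishing numerator. This identifies the
    boundary value [eta] left open by [has_angular_derivative]. *)
Lemma cvg_quotient_numerator (R : realType) T (F : set_system T) (FF : Filter F)
    (u v : T -> R[i]) (a b d : R[i]) :
  v @ F --> b -> (\forall t \near F, v t - b != 0) ->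
  (u t - a) / (v t - b) @[t --> F] --> d -> u @ F --> a.
Proof.
move=> vb vN uvd.
have h : (u t - a) / (v t - b) * (v t - b) + a @[t --> F] --> d * (b - b) + a.
  apply: cvgD; last exact: cvg_cst.
  apply: cvgM; first exact: uvd.
  by apply: cvgB; [exact: vb|exact: cvg_cst].
rewrite subrr mulr0 add0r in h.
apply: cvg_trans h; apply: near_eq_cvg.
by apply: filterS vN => t tN; rewrite divfK // subrK.
Qed.

Lemma symbol_contracts_near (R : realType) (phi : disc_symbol R) (z0 : R[i]) :
  hyperbolic phi z0 -> holomorphic_extension_near phi z0 ->
  exists2 c : R, 0 <= c < 1 &
    \forall z \near z0, closed_unit_disc z -> `|phi z - z0| <= c%:C * `|z - z0|.
Proof.
move=> [z01 dw [d [eta eta1 ang] d1]] [g gd gphi].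
have phiz0 := denjoy_wolff_fixed dw.
have z0D : closed_unit_disc z0 by rewrite /closed_unit_disc /= z01.
have gz0 : g z0 = z0 by rewrite (nbhs_singleton gphi).
have F0 : ProperFilter (0 : R)^'+ by exact: at_right_proper_filter.
pose p t := radial z0 t.
have pz0 : p t @[t --> (0 : R)^'+] --> z0 by exact: cvg_radial.
have pN : \forall t \near (0 : R)^'+, p t - z0 != 0.
  have := near_radial R; apply: filterS => t /andP[t0 _].
  by rewrite -normr_eq0 norm_radialB // gt_eqF // ltcR.
have pS : p t @[t --> (0 : R)^'+] --> within (stolz_region z0 2) (nbhs z0).
  move=> A A1.
  have A2 : \forall t \near (0 : R)^'+, stolz_region z0 2 (p t) -> A (p t).
    exact: (pz0 _ A1).
  apply: filterS2 A2 (near_radial R) => t + t01; apply.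
  by apply: radial_stolz => //; rewrite ltr1n.
have pd : (phi (p t) - eta) / (p t - z0) @[t --> (0 : R)^'+] --> d%:C.
  by apply: cvg_comp pS (ang 2 _); rewrite ltr1n.
have phip : phi (p t) @[t --> (0 : R)^'+] --> phi z0.
  refine (@disc_algebra_cvg R phi z0 R (0 : R)^'+ _ p z0D _ pz0).
  have := near_radial R; apply: filterS => t t01.
  exact/unit_disc_closed/radial_unit_disc.
rewrite phiz0 in phip.
(* Along the radius [phi] tends to [z0] by continuity and to [eta] because the quotient
   converges. *)
have etaE : eta = z0.
  symmetry; apply: (complex_cvg_unique F0 phip).
  exact: cvg_quotient_numerator pz0 pN pd.
rewrite {eta eta1}etaE in ang pd.
have d0 : 0 <= d.
  (* If [d < 0], a radial quotient closer than [- d] to [d] would have negative real part. *)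
  rewrite leNgt; apply/negP => dlt.
  have Nd0 : 0 < (- d)%:C :> R[i] by rewrite ltcR oppr_gt0.
  move/cvgrPdist_lt : pd => /(_ _ Nd0) pd.
  have [t [t01 tdist]] := @filter_ex _ _ F0 _ (filterI (near_radial R) pd).
  have := Re_radial_quotient_ge0 phi z01 t01; apply/negP; rewrite -ltNge.
  have : (complex.Re ((phi (p t) - z0) / (p t - z0)) - d)%:C < (- d)%:C.
    apply: le_lt_trans tdist; rewrite distrC; apply: le_trans (Re_le_norm _).
    by rewrite lecR; case: (_ / _) => a b.
  by rewrite ltcR ltrBlDr addNr.
have [D gD] : exists D : R[i],
    (fun h : R[i] => h^-1 * (g (h + z0) - z0)) @ (0 : R[i])^' --> D.
  have /cvg_ex[D] := nbhs_singleton gd; exists D.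
  apply: cvg_trans p0; apply: near_eq_cvg; apply: nearW => h /=.
  by rewrite gz0 [h%:A]mulr1.
(* The extension [g] has an unrestricted derivative [D]; on the radius its quotients are those of
   [phi], which tend to [d]. *)
have DE : D = d%:C.
  symmetry; apply: (complex_cvg_unique F0 pd).
  have pd0 : p t - z0 @[t --> (0 : R)^'+] --> (0 : R[i])^'.
    move=> A A0; have A1 : \forall h \near (0 : R[i]), h != 0 -> A h by exact: A0.
    have A2 : \forall t \near (0 : R)^'+, p t - z0 != 0 -> A (p t - z0).
      have A3 : nbhs z0 (fun w : R[i] => w - z0 != 0 -> A (w - z0)).
        exact: near_subr A1.
      exact: (pz0 _ A3).
    by apply: filterS2 A2 pN => t; exact.
  have := cvg_comp _ _ pd0 gD; apply: cvg_trans; apply: near_eq_cvg.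
  have gp : \forall t \near (0 : R)^'+,
      closed_unit_disc (p t) -> g (p t) = phi (p t).
    exact: (pz0 _ gphi).
  apply: filterS2 (near_radial R) gp => t t01 /= gpt.
  rewrite subrK gpt; first by rewrite mulrC.
  exact/unit_disc_closed/radial_unit_disc.
(* The midpoint of [d] and [1]: it leaves the margin [(1 - d) / 2] for the error of the difference
   quotient. *)
exists ((1 + d) / 2).
  by rewrite divr_ge0 ?addr_ge0 // ltr_pdivrMr // mul1r ltrD2l.
have e0 : 0 < ((1 - d) / 2)%:C :> R[i] by rewrite ltcR divr_gt0 ?subr_gt0.
move/cvgrPdist_lt : gD => /(_ _ e0) gD.
have {}gD : \forall h \near (0 : R[i]), h != 0 ->
  `|D - h^-1 * (g (h + z0) - z0)| < ((1 - d) / 2)%:C by exact: gD.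
have {}gD : \forall z \near z0, z - z0 != 0 ->
  `|D - (z - z0)^-1 * (g (z - z0 + z0) - z0)| <
    ((1 - d) / 2)%:C by exact: near_subr gD.
apply: filterS2 gphi gD => z gz hz zD.
have [->|zN] := eqVneq z z0; first by rewrite phiz0 subrr normr0 mulr0.
move: hz; rewrite subr_eq0 zN subrK gz // => /(_ isT) hz.
rewrite -ler_pdivrMr ?normr_gt0 ?subr_eq0 // -normf_div.
have -> : ((1 + d) / 2)%:C = ((1 - d) / 2)%:C + d%:C :> R[i].
  by rewrite -rmorphD; congr (_ %:C); field.
rewrite -[X in `|X|](subrK D) (le_trans (ler_normD _ _)) // lerD //.
  by rewrite distrC mulrC ltW.
by rewrite DE norm_real_complex ger0_norm.
Qed.

(** * Trapped orbits and uniform convergence on the closed disc *)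

Lemma iter_trap (R : realType) (phi : disc_symbol R) (z0 e : R[i]) (c : R) :
  0 <= c <= 1 ->
  (forall z, `|z0 - z| < e -> closed_unit_disc z ->
    `|phi z - z0| <= c%:C * `|z - z0|) ->
  forall n z, `|z0 - z| < e -> closed_unit_disc z ->
    `|iter n phi z - z0| <= (c ^+ n)%:C * `|z - z0|.
Proof.
move=> /andP[c0 c1] phic; elim=> [|n IHn] z ze zD; first by rewrite expr0 mul1r.
rewrite exprS rmorphM -mulrA /=.
apply: le_trans (_ : c%:C * `|iter n phi z - z0| <= _).
  (* The contraction estimate is available only in the ball; as [c ^+ n <= 1], the orbit has not
     left it. *)
  apply: phic; last exact: closed_unit_disc_iter.
  rewrite distrC; apply: le_lt_trans (IHn z ze zD) _.
  rewrite distrC in ze; apply: le_lt_trans ze.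
  by rewrite ler_piMl // -(rmorph1 (real_complex R)) lecR exprn_ile1.
by rewrite ler_wpM2l ?ler0c // IHn.
Qed.

Lemma trapped_cvg (R : realType) (phi : disc_symbol R) (z0 z : R[i]) (c : R) :
  0 <= c < 1 ->
  (forall n, `|iter n phi z - z0| <= (c ^+ n)%:C * `|z - z0|) ->
  iter n phi z @[n --> \oo] --> z0.
Proof.
move=> /andP[c0 c1] zc; apply/cvgrPdist_lt => e e0.
have [k0|kN] := eqVneq `|z - z0| 0.
  apply: nearW => n; rewrite distrC; apply: le_lt_trans (zc n) _.
  by rewrite k0 mulr0.
have k0 : 0 < `|z - z0| by rewrite lt_neqAle eq_sym kN normr_ge0.
have /gt0_complexE[ekE ek0] : 0 < e / `|z - z0| by rewrite divr_gt0.
have /cvgrPdist_lt/(_ _ ek0) : (GRing.exp c : R^nat) @ \oo --> (0 : R).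
  by apply: cvg_expr; rewrite ger0_norm.
apply: filterS => n; rewrite sub0r normrN ger0_norm ?exprn_ge0 // => cn.
rewrite distrC; apply: le_lt_trans (zc n) _.
by rewrite -ltr_pdivlMr // ekE ltcR.
Qed.

(** If [N] iterations bring [z] into a small ball around [z0], continuity of the [N]-th iterate
    brings the neighbours of [z] there too, and all of them stay trapped. Finitely many such
    neighbourhoods cover the disc. *)
Lemma iter_symbol_uniform (R : realType) (phi : disc_symbol R) (z0 : R[i]) (c : R) :
  0 <= c <= 1 ->
  (\forall z \near z0, closed_unit_disc z -> `|phi z - z0| <= c%:C * `|z - z0|) ->
  (forall z, closed_unit_disc z -> iter n phi z @[n --> \oo] --> z0) ->
  forall A : set R[i], nbhs z0 A ->
    \forall n \near \oo, forall z, closed_unit_disc z -> A (iter n phi z).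
Proof.
move=> c01 phic phiz A A0.
have /nbhs_normP[e /= e0 eP] : \forall z \near z0,
    (closed_unit_disc z -> `|phi z - z0| <= c%:C * `|z - z0|) /\ A z.
  exact: filterI phic A0.
have trap : forall n z, `|z0 - z| < e -> closed_unit_disc z ->
    `|iter n phi z - z0| <= `|z - z0|.
  move=> n z ze zD; apply: le_trans (iter_trap c01 _ n ze zD) _.
    by move=> w /eP[].
  have /andP[c0 c1] := c01.
  by rewrite ler_piMl // -(rmorph1 (real_complex R)) lecR exprn_ile1.
suff : \forall n \near \oo, (@closed_unit_disc R) `<=`
    (fun z => closed_unit_disc z -> A (iter n phi z)).
  by apply: filterS => n nA z zD; exact: nA.
have /compact_near_coveringP cover := closed_unit_disc_compact (R := R).
apply: (cover nat \oo (fun n z => closed_unit_disc z -> A (iter n phi z))) => z zD.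
have /cvgrPdist_lt/(_ _ e0)/filter_ex[N /= zN] := phiz z zD.
(* The room left between the [N]-th iterate of [z] and the edge of the ball. *)
have ez : 0 < e - `|z0 - iter N phi z| by rewrite subr_gt0.
have /cvgrPdist_lt/(_ _ ez) := @iter_symbol_cvg _ phi N z zD.
rewrite near_withinE => zw.
exists ((fun w => closed_unit_disc w ->
           `|iter N phi z - iter N phi w| < e - `|z0 - iter N phi z|),
        [set n | (N <= n)%N]) => /=.
  by split=> //; exact: nbhs_infty_ge.
move=> [w n] /= [hw Nn] wD.
have wN : `|z0 - iter N phi w| < e.
  rewrite (le_lt_trans (ler_distD (iter N phi z) _ _)) // addrC -ltrBrDr.
  exact: hw.
(* The remaining [n - N] iterations do not increase the distance to [z0], and the ball lies in
   [A]. *)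
rewrite -(subnK Nn) iterD; apply: (eP _ _).2; rewrite /=.
rewrite distrC (le_lt_trans (trap _ _ wN _)) //; last by rewrite distrC.
exact: closed_unit_disc_iter.
Qed.

(** * Evaluation at the fixed point as the ergodic limit *)

Lemma disc_algebra_cst_in (R : realType) (a : R[i]) :
  (fun z : R[i] => if `|z| <= 1 then a else 0) \in @disc_algebra_pred R.
Proof.
apply/asboolP; split.
- apply/subspace_continuousP => z zD.
  rewrite /from_subspace ifT //.
  apply: (@cvg_trans _ (cst a @ within (@closed_unit_disc R) (nbhs z))).
    2: exact: cvg_cst.
  apply: near_eq_cvg; rewrite near_withinE; apply: nearW => w wD.
  by rewrite ifT.
(* The cut-off is invisible near a point of the open disc. *)
- move=> z zD; apply: (@near_eq_derivable _ _ _ (cst a)) (derivable_cst _ _ _).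
  have : \forall w \near z, Normc.normc w < 1.
    apply: (@normc_continuous R z [set x : R | x < 1]).
    by apply: open_nbhs_nbhs; split; [exact: open_lt|rewrite /= -ltcR].
  apply: filterS => w w1; rewrite ifT //.
  by rewrite Defs.normcE lecR ltW.
- by move=> z zD; case: ifP => // /zD.
Qed.

Definition disc_algebra_cst (R : realType) (a : R[i]) : disc_algebra R :=
  DiscAlgebra (disc_algebra_cst_in a).

Lemma disc_algebra_cstE (R : realType) (a z : R[i]) :
  closed_unit_disc z -> disc_algebra_cst a z = a.
Proof. by move=> zD /=; rewrite ifT. Qed.

Definition eval_proj (R : realType) (z0 : R[i]) (f : disc_algebra R) :
    disc_algebra R :=
  disc_algebra_cst (f z0).

Lemma eval_proj_is_linear (R : realType) (z0 : R[i]) : linear (eval_proj z0).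
Proof.
move=> a f g; apply: disc_algebra_ext => z z1.
rewrite -[RHS]/(a * eval_proj z0 f z + eval_proj z0 g z).
by rewrite !disc_algebra_cstE.
Qed.

HB.instance Definition _ (R : realType) (z0 : R[i]) :=
  GRing.isLinear.Build R[i] (disc_algebra R) (disc_algebra R) _ (eval_proj z0)
    (eval_proj_is_linear z0).

Lemma eval_proj_continuous (R : realType) (z0 : R[i]) :
  closed_unit_disc z0 -> continuous (eval_proj z0).
Proof.
move=> z0D; apply: bounded_linear_continuous; apply/linear_boundedP.
near=> r => f; apply: (@le_trans _ _ `|f|).
  apply: disc_algebra_norm_le => // z z1.
  by rewrite disc_algebra_cstE // disc_algebra_norm_ge.
have r1 : 1 <= r by near: r; apply: nbhs_pinfty_ge; rewrite real1.
by rewrite -[leLHS]mul1r ler_wpM2r.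
Unshelve. all: by end_near. Qed.

Lemma comp_op_mean_ergodic (R : realType) (phi : disc_symbol R) (z0 : R[i]) :
  closed_unit_disc z0 ->
  (forall A : set R[i], nbhs z0 A ->
    \forall n \near \oo, forall z, closed_unit_disc z -> A (iter n phi z)) ->
  mean_ergodic (comp_op phi).
Proof.
move=> z0D unif; split; first exact: comp_op_continuous.
exists (eval_proj z0); first exact: eval_proj_continuous.
move=> f; apply: cvg_cesaro; apply/cvgrPdist_lt => e e0.
have e20 : 0 < e / 2 by rewrite divr_gt0.
have [fc _ _] := disc_algebraP f.
have /cvgrPdist_lt/(_ _ e20) := (subspace_continuousP _ _).1 fc z0 z0D.
(* Uniformity is used for the neighbourhood of [z0] whose points in the closed disc satisfy the
   [e / 2] estimate. The factor 2 restores strictness, as a supremum yields only a weak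
   inequality. *)
rewrite near_withinE => /unif; apply: filterS => n hn.
apply: (@le_lt_trans _ _ (e / 2)); last by rewrite ltr_pdivrMr // ltr_pMr // ltr1n.
apply: disc_algebra_norm_le; first exact: ltW.
move=> z zD.
rewrite -[X in `|X|]/(disc_algebra_cst (f z0) z - iter n (comp_op phi) f z).
rewrite disc_algebra_cstE // iter_comp_opE //; apply/ltW/hn => //.
exact: closed_unit_disc_iter.
Qed.

(** * Extreme points and convergence of means *)

Lemma Re_le_chord (R : realType) (u : R[i]) (r : R) : 0 <= r ->
  `|u| <= 1 -> r%:C <= `|u - 1| -> complex.Re u <= 1 - r ^+ 2 / 2.
Proof.
move=> r0 u1 ru.
have {u1} : `|u| ^+ 2 <= 1 by rewrite exprn_ile1.
have {ru} : r%:C ^+ 2 <= `|u - 1| ^+ 2.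
  by rewrite lerXn2r ?nnegrE ?normr_ge0 ?ler0c.
have nE (v : R[i]) : `|v| ^+ 2 = (complex.Re v ^+ 2 + complex.Im v ^+ 2)%:C.
  exact/esym/add_Re2_Im2.
rewrite !nE -rmorphXn lecR -(rmorph1 (real_complex R)) lecR.
(* For [|u| <= 1], expanding gives [|u - 1|^2 = |u|^2 - 2 Re u + 1 <= 2 (1 - Re u)]. *)
case: u => a b /= h1 h2; move: h1; rewrite subr0 => h1; nra.
Qed.

(* [Re_le_chord] makes the extremality of [z0] quantitative: the closed disc minus the
   [e]-ball around [z0] lies in a half-plane that misses [z0]. *)
Lemma mean_cvg_extreme (R : realType) (w : nat -> R[i]) (z0 e : R[i]) :
  `|z0| = 1 -> 0 < e -> (forall n, `|w n| <= 1) ->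
  n%:R^-1 *: (\sum_(1 <= m < n.+1) w m) @[n --> \oo] --> z0 ->
  exists m, `|z0 - w m| < e.
Proof.
move=> z01 /gt0_complexE[-> ]; move: (complex.Re e) => r r0 w1 wz0.
apply: contrapT => /forallNP far.
have z0N : z0 != 0 by rewrite -normr_eq0 z01 oner_eq0.
(* Division by [z0] rotates the extreme point to [1]. A half-plane is convex, so the bound passes to
   the means and keeps them [r ^+ 2 / 2] away from [z0]. *)
have Rew m : complex.Re (w m / z0) <= 1 - r ^+ 2 / 2.
  apply: Re_le_chord; first exact: ltW.
    by rewrite normf_div z01 divr1.
  have -> : w m / z0 - 1 = (w m - z0) / z0 by rewrite mulrBl divff.
  rewrite normf_div z01 divr1 distrC.
  by rewrite real_leNgt ?normr_real ?ger0_real ?ler0c ?(ltW r0) //; apply/negP.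
have e0 : 0 < (r ^+ 2 / 2)%:C :> R[i] by rewrite ltcR divr_gt0 ?exprn_gt0.
move/cvgrPdist_lt : wz0 => /(_ _ e0) wz0.
have [n [/= hn n0]] := filter_ex (filterI wz0 (nbhs_infty_gt 0)).
suff /le_lt_trans/(_ hn) : (r ^+ 2 / 2)%:C <=
    `|z0 - n%:R^-1 *: \sum_(1 <= m < n.+1) w m| by rewrite ltxx.
set S := \sum_(_ <= _ < _) _.
have ReS : complex.Re (S / z0) <= n%:R * (1 - r ^+ 2 / 2).
  rewrite /S mulr_suml raddf_sum /=.
  apply: (@le_trans _ _ (\sum_(1 <= i < n.+1) (1 - r ^+ 2 / 2))).
    by apply: ler_sum => i _.
  by rewrite sumr_const_nat subSS subn0 mulr_natl.
have -> : z0 - n%:R^-1 *: S = z0 * (1 - (n%:R^-1)%:C * (S / z0)).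
  rewrite fmorphV rmorph_nat -[n%:R^-1 *: S]/(n%:R^-1 * S); field.
  by rewrite z0N pnatr_eq0 -lt0n n0.
rewrite normrM z01 mul1r.
apply: le_trans (Re_le_norm _); rewrite lecR.
have -> : complex.Re (1 - (n%:R^-1)%:C * (S / z0)) =
    1 - n%:R^-1 * complex.Re (S / z0).
  by case: (S / z0) => a b; simpc.
rewrite lerBrDr addrC -lerBrDr ler_pdivrMl ?ltr0n //.
Qed.

(** * From mean ergodicity to convergence of every orbit *)

Lemma mean_ergodic_mean_cvg (R : realType) (phi : disc_symbol R) (z0 z : R[i]) :
  denjoy_wolff_point phi z0 -> mean_ergodic (comp_op phi) -> closed_unit_disc z ->
  n%:R^-1 *: (\sum_(1 <= m < n.+1) iter m.+1 phi z) @[n --> \oo] --> z0.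
Proof.
move=> dw [_ [P _ Pcvg]].
(* [phi] itself serves as the test function: its [m]-th image under the operator is the iterate of
   order [m.+1], whence the shifted index. *)
pose g := P phi.
have mean_eval (v : R[i]) : closed_unit_disc v ->
    n%:R^-1 *: (\sum_(1 <= m < n.+1) iter m.+1 phi v) @[n --> \oo] --> g v.
  move=> v1; apply/cvgrPdist_lt => e e0.
  have /cvgrPdist_lt/(_ _ e0) := Pcvg (phi : disc_algebra R).
  apply: filterS => n; apply: le_lt_trans.
  apply: le_trans (disc_algebra_norm_ge _ v1).
  rewrite -[X in _ <= `|X|]/(g v -
    n%:R^-1 * (\sum_(1 <= m < n.+1) iter m (comp_op phi) phi) v).
  rewrite (_ : (\sum_(1 <= m < n.+1) iter m (comp_op phi) phi) v =
      \sum_(1 <= m < n.+1) iter m.+1 phi v) //.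
  rewrite (big_morph (fun f : disc_algebra R => f v) (id1 := 0) (op1 := +%R)) //.
  by apply: eq_bigr => m _; rewrite iter_comp_opE.
have gD (v : R[i]) : unit_disc v -> g v = z0.
  move=> v1; apply: complex_cvg_unique (mean_eval v (unit_disc_closed v1)) _.
  apply: cvg_cesaro; have := denjoy_wolff_cvg dw v1.
  by rewrite -(cvg_shiftS (fun n => iter n phi v)).
move=> z1; rewrite (_ : z0 = g z); first exact: mean_eval.
(* The value [z0] of [g] on the open disc is carried to the boundary along a radius. *)
have rg : g (radial z t) @[t --> (0 : R)^'+] --> g z.
  refine (@disc_algebra_cvg R g z R (0 : R)^'+ _ (radial z) z1 _ (@cvg_radial R z)).
  have := near_radial R; apply: filterS => t t01.
  exact/unit_disc_closed/radial_unit_disc.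
apply: (@complex_cvg_unique R R (0 : R)^'+ _ (fun t => g (radial z t))) rg.
apply: cvg_near_cst; have := near_radial R; apply: filterS => t t01.
by rewrite gD //; apply: radial_unit_disc.
Qed.

Theorem theorem3p9 (R : realType) (phi : disc_symbol R) (z0 : R[i])
    (phi_hyperbolic : hyperbolic phi z0)
    (phi_holomorphic : holomorphic_extension_near phi z0) :
  mean_ergodic (comp_op phi) <->
  (forall z : R[i], `|z| <= 1 -> iter n phi z @[n --> \oo] --> z0).
Proof.
have [c c01 phic] := symbol_contracts_near phi_hyperbolic phi_holomorphic.
have c01' : 0 <= c <= 1 by case/andP: c01 => -> /ltW.
have [z01 dw _] := phi_hyperbolic.
split=> [erg z z1|phiz]; last first.
  apply: (@comp_op_mean_ergodic _ _ z0); first by rewrite /closed_unit_disc /= z01.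
  exact: iter_symbol_uniform c01' phic phiz.
have /nbhs_normP[e /= e0 eP] := phic.
have z1' := closed_unit_disc_iter phi _ z1.
have [m zm] := mean_cvg_extreme z01 e0 (fun n => z1' n.+1)
  (mean_ergodic_mean_cvg dw erg z1).
(* From time [m.+1] on the orbit of [z] is trapped, and convergence of this tail gives that of the
   whole orbit. *)
have := trapped_cvg c01 (fun n => iter_trap c01' eP n zm (z1' m.+1)).
have itE n : iter n phi (iter m.+1 phi z) = iter (n + m.+1) phi z by rewrite iterD.
under eq_fun do rewrite itE.
by rewrite (cvg_shiftn m.+1 (fun n => iter n phi z)).
Qed.
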